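(* There exists an algorithm that, given speed limits $v_1,\dots,v_k>0$, an idle time $T>0$ and $\varepsilon>0$, outputs (a finite description of) a schedule for $k$ agents with speed limits $v_1,\dots,v_k$ that patrols, with idle time $T$, a fence of length at least $(1-\varepsilon)L$ for every $L$ such that some schedule of these agents patrols a fence of length $L$ with idle time $T$.
   Context: A fence of length $L$ is the interval $[0,L]$. A schedule for $k$ agents with speed limits $v_1,\dots,v_k$ is a $k$-tuple $(a_1,\dots,a_k)$ of functions $a_i\colon\mathbb{R}\to\mathbb{R}$ with $|a_i(s)-a_i(t)|\le v_i|s-t|$ for all $s,t$. It patrols the fence $[0,L]$ with idle time $T$ if for every $t\in\mathbb{R}$ and every $x\in[0,L]$ there are an agent $i$ and $t'\in[t,t+T)$ with $a_i(t')=x$. *)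

(* Defs.v *)
From mathcomp Require Import all_boot all_order all_algebra.
From mathcomp Require Import reals.
Set Implicit Arguments.
Unset Strict Implicit.
Unset Printing Implicit Defensive.
Import Order.TTheory GRing.Theory Num.Theory.
Local Open Scope ring_scope.

Definition is_schedule (R : realType) (k : nat) (v : 'I_k -> R)
    (a : 'I_k -> R -> R) : Prop :=
  forall (i : 'I_k) (s t : R), `|a i s - a i t| <= v i * `|s - t|.

Definition patrols (R : realType) (k : nat) (a : 'I_k -> R -> R)
    (L T : R) : Prop :=
  forall t x : R, 0 <= x <= L ->
    exists (i : 'I_k) (t' : R), t <= t' < t + T /\ a i t' = x.

(* Kleene's partial recursive functions of several natural numbers, relative
   to an oracle.  [eval o p xs y] reads: the program p, run on the arguments xs
   with the oracle o, halts with output y.  Missing arguments count as 0. *)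
Inductive program : Type :=
  | Zero
  | Succ
  | Proj of nat
  | Query
  | Comp of program & seq program
  | PrimRec of program & program
  | Mu of program.

Fixpoint eval (o : nat -> nat -> nat) (p : program) (xs : seq nat) (y : nat)
    {struct p} : Prop :=
  match p with
  | Zero => y = 0%N
  | Succ => y = (nth 0%N xs 0).+1
  | Proj i => y = nth 0%N xs i
  | Query => y = o (nth 0%N xs 0) (nth 0%N xs 1)
  | Comp f gs =>
      exists zs : seq nat,
        (fix evals (gs : seq program) (zs : seq nat) : Prop :=
           match gs, zs with
           | [::], [::] => True
           | g :: gs', z :: zs' => eval o g xs z /\ evals gs' zs'
           | _, _ => False
           end) gs zs
        /\ eval o f zs y
  | PrimRec f g =>
      (fix rec (n y : nat) : Prop :=
         match n with
         | 0 => eval o f (behead xs) y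
         | m.+1 => exists z, rec m z /\ eval o g [:: m, z & behead xs] y
         end) (nth 0%N xs 0) y
  | Mu f =>
      eval o f (y :: xs) 0
      /\ forall z, (z < y)%N -> exists w, eval o f (z :: xs) w.+1
  end.

(* A real number x >= 0 is presented to a program by dyadic approximations:
   on query n, the answer m satisfies |x - m / 2^n| <= 2^-n. *)
Definition approximates (R : realType) (u : nat -> nat) (x : R) : Prop :=
  forall n : nat, `|x - (u n)%:R / 2 ^+ n| <= 2 ^- n.

(* The finite description of a schedule: every agent moves periodically and
   piecewise linearly.  At time j * step / den, for j in Z, agent i is at the
   point w_(j mod size w) / den, where w is the i-th entry of waypoints; in
   between, it moves with constant velocity. *)
Record description : Type := Description {
  den : nat;
  step : nat;
  waypoints : seq (seq nat)
}.

Definition encode (d : description) : nat :=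
  CodeSeq.code [:: den d, step d & map CodeSeq.code (waypoints d)].

Definition cyclic_nth (w : seq nat) (j : int) : nat :=
  nth 0%N w `|(j %% (size w)%:Z)%Z|%N.

Definition schedule_of (R : realType) (k : nat) (d : description)
    (i : 'I_k) (t : R) : R :=
  let w := nth [::] (waypoints d) i in
  let s := t / ((step d)%:R / (den d)%:R) in
  let j := Num.floor s in
  let r := s - j%:~R in
  ((1 - r) * (cyclic_nth w j)%:R + r * (cyclic_nth w (j + 1))%:R) / (den d)%:R.
Arguments schedule_of R k d i t : clear implicits.

(* Main.v *)
Require Import Defs.
From mathcomp Require Import all_boot all_order all_algebra.
From mathcomp Require Import reals boolp.
From mathcomp Require Import zify ring lra.
Import Order.TTheory GRing.Theory Num.Theory.

(* The program searches exhaustively through periodic schedules on a grid.  Let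
   1 / E < eps with E a power of 2, and let D = 2^n be large.  Time is measured
   in units of 1 / D and space in units of 1 / D^2; a table of integer positions
   is accepted if no agent exceeds its speed limit between consecutive times and
   every cell of the fence is crossed by some agent in every window of W steps,
   where W is slightly less than T D.

   An arbitrary schedule loses only a factor 1 - 1 / E when it is turned into
   such a table.  Shrinking space by 1 - 1 / E buys speed, which is spent on
   running through the schedule 1 + 1 / (2 E) times faster, and the time gained
   in this way allows each agent to stop, once in every block of 12 E steps, at
   the moments when its position is minimal and maximal in that block; between
   these stops it crosses all the cells it visits in the block.  Positions are
   bounded, so two windows of length W agree, and repeating the part between
   them gives a periodic table whose period divides a computable number. *)

(** * Computable functions *)

(** One program serves all oracles, and it must halt on every argument list of length [n]. *)
Definition computable (n : nat) (f : (nat -> nat -> nat) -> seq nat -> nat) :=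
  exists p, forall o xs, size xs = n -> eval o p xs (f o xs).

Lemma eval_comp o f gs xs zs y : size gs = size zs ->
  (forall i, i < size gs -> eval o (nth Zero gs i) xs (nth 0 zs i)) ->
  eval o f zs y -> eval o (Comp f gs) xs y.
Proof.
move=> szg gsP fP; exists zs; split=> //.
elim: gs zs szg gsP {fP} => [|g gs IH] [|z zs] //= [szg] gsP.
split; first exact: (gsP 0).
by apply: IH => // i lti; apply: (gsP i.+1).
Qed.

Lemma eval_primrec o f g m xs z (h : nat -> nat) :
  eval o f xs (h 0) ->
  (forall i, eval o g [:: i, h i & xs] (h i.+1)) ->
  z = h m -> eval o (PrimRec f g) (m :: xs) z.
Proof.
move=> f0 gS -> /=; elim: m => [|m IH] //.
by exists (h m); split.
Qed.

Lemma computable_ext n f g : (forall o xs, f o xs = g o xs) ->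
  computable n f -> computable n g.
Proof. by move=> fg [p pP]; exists p => o xs szx; rewrite -fg; apply: pP. Qed.

Lemma computable_nth n i : computable n (fun _ xs => nth 0 xs i).
Proof. by exists (Proj i). Qed.

Lemma computable_subst n m f gs : size gs = m -> computable m f ->
  foldr (fun g => and (computable n g)) True gs ->
  computable n (fun o xs => f o [seq g o xs | g <- gs]).
Proof.
move=> szg [p pP] gsP.
have [ps [szp psP]] : exists ps, size ps = size gs /\ forall o xs i,
    size xs = n -> i < size gs ->
    eval o (nth Zero ps i) xs (nth (fun _ _ => 0) gs i o xs).
  elim: gs gsP {szg} => [|g gs IH] /=; first by exists [::].
  move=> [[q qP] /IH[ps [szp psP]]]; exists (q :: ps); split=> /=.
    by rewrite szp.
  by move=> o xs [|i] szx lti //=; [apply: qP | apply: psP].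
exists (Comp p ps) => o xs szx.
apply: (@eval_comp _ _ _ _ [seq g o xs | g <- gs]).
- by rewrite size_map.
- move=> i; rewrite szp => lti.
  by rewrite (nth_map (fun _ _ => 0)) //; apply: psP.
by apply: pP; rewrite size_map.
Qed.

Lemma computable_comp1 n (F : (nat -> nat -> nat) -> nat -> nat) f :
  computable 1 (fun o xs => F o (nth 0 xs 0)) -> computable n f ->
  computable n (fun o xs => F o (f o xs)).
Proof.
move=> FP fP; apply: (@computable_subst n 1 _ [:: f] _ FP) => //.
Qed.

Lemma computable_comp2 n (F : (nat -> nat -> nat) -> nat -> nat -> nat) f g :
  computable 2 (fun o xs => F o (nth 0 xs 0) (nth 0 xs 1)) ->
  computable n f -> computable n g ->
  computable n (fun o xs => F o (f o xs) (g o xs)).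
Proof.
move=> FP fP gP; apply: (@computable_subst n 2 _ [:: f; g] _ FP) => //.
Qed.

Lemma computable_shift n f : computable n f ->
  computable n.+1 (fun o xs => f o (behead xs)).
Proof.
move=> [p pP]; exists (Comp p [seq Proj i.+1 | i <- iota 0 n]) => o xs szx.
have szb : size (behead xs) = n by rewrite size_behead szx.
apply: (@eval_comp _ _ _ _ (behead xs)); last exact: pP.
  by rewrite size_map size_iota szb.
move=> i; rewrite size_map size_iota => lti.
by rewrite (nth_map 0) ?size_iota // nth_iota //= nth_behead.
Qed.

Lemma computable_nth_behead n f i : computable n (fun o xs => nth 0 (f o xs) i.+1) ->
  computable n (fun o xs => nth 0 (behead (f o xs)) i).
Proof. by apply: computable_ext => o xs; rewrite nth_behead. Qed.

Lemma computable_succ n f : computable n f -> computable n (fun o xs => (f o xs).+1).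
Proof. by apply: (@computable_comp1 n (fun _ => succn)); exists Succ. Qed.

Lemma computable_const n c : computable n (fun _ _ => c).
Proof.
by elim: c => [|c IH]; [exists Zero | apply: computable_succ].
Qed.

Lemma computable_query n f g : computable n f -> computable n g ->
  computable n (fun o xs => o (f o xs) (g o xs)).
Proof. by apply: (@computable_comp2 n (fun o => o)); exists Query. Qed.

(** Primitive recursion with parameters: the step finds the counter at index 0, the accumulator at
    index 1 and the parameters behind them. *)
Lemma computable_iteri n h f
    (G : (nat -> nat -> nat) -> seq nat -> nat -> nat -> nat) :
  computable n h -> computable n f ->
  computable n.+2
    (fun o xs => G o (behead (behead xs)) (nth 0 xs 0) (nth 0 xs 1)) ->
  computable n (fun o xs => iteri (h o xs) (G o xs) (f o xs)).
Proof.
move=> [ph hP] [pf fP] [pg gP].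
exists (Comp (PrimRec pf pg) (ph :: [seq Proj i | i <- iota 0 n])) => o xs szx.
apply: (@eval_comp _ _ _ _ (h o xs :: xs)).
- by rewrite /= size_map size_iota szx.
- move=> [|i] /=; first by move=> _; apply: hP.
  rewrite size_map size_iota ltnS => lti.
  by rewrite (nth_map 0) ?size_iota // nth_iota.
apply: (@eval_primrec _ _ _ _ _ _ (fun m => iteri m (G o xs) (f o xs))) => //.
  exact: fP.
by move=> i; apply: (gP o [:: i, _ & xs]); rewrite /= szx.
Qed.

(** [~~ P] has the value 0 exactly where [P] holds, so minimization halts at the least witness;
    nothing is claimed if there is none. *)
Lemma computable_mu n (P : (nat -> nat -> nat) -> nat -> seq nat -> bool) :
  computable n.+1 (fun o xs => ~~ P o (nth 0 xs 0) (behead xs)) ->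
  exists p, forall o xs, size xs = n -> (exists y, P o y xs) ->
    exists y, P o y xs /\ eval o p xs y.
Proof.
move=> [p pP]; exists (Mu p) => o xs szx exP.
exists (ex_minn exP); case: ex_minnP => y Py ymin; split=> //=; split.
  by have := pP o (y :: xs); rewrite /= szx Py; apply.
move=> z lty; exists 0; have := pP o (z :: xs); rewrite /= szx.
case Pz: (P o z xs); last exact.
by move: lty; rewrite ltnNge ymin.
Qed.

Lemma computable_add n f g : computable n f -> computable n g ->
  computable n (fun o xs => f o xs + g o xs).
Proof.
apply: (@computable_comp2 n (fun _ => addn)).
apply: (@computable_ext _ (fun _ xs => iteri (nth 0 xs 0) (fun _ => succn) (nth 0 xs 1))).
  by move=> o xs; elim: (nth 0 xs 0) => //= m ->.
apply: computable_iteri; try exact: computable_nth.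
by apply: computable_succ; apply: computable_nth.
Qed.

Lemma computable_mul n f g : computable n f -> computable n g ->
  computable n (fun o xs => f o xs * g o xs).
Proof.
apply: (@computable_comp2 n (fun _ => muln)).
apply: (@computable_ext _
  (fun _ xs => iteri (nth 0 xs 0) (fun _ => addn (nth 0 xs 1)) 0)).
  by move=> o xs; elim: (nth 0 xs 0) => //= m ->.
apply: computable_iteri; [exact: computable_nth | exact: computable_const |].
apply: computable_add; last exact: computable_nth.
by do 2! apply: computable_nth_behead; apply: computable_nth.
Qed.

Lemma computable_exp n f g : computable n f -> computable n g ->
  computable n (fun o xs => f o xs ^ g o xs).
Proof.
apply: (@computable_comp2 n (fun _ => expn)).
apply: (@computable_ext _
  (fun _ xs => iteri (nth 0 xs 1) (fun _ => muln (nth 0 xs 0)) 1)).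
  by move=> o xs; elim: (nth 0 xs 1) => //= m ->; rewrite expnS.
apply: computable_iteri; [exact: computable_nth | exact: computable_const |].
apply: computable_mul; last exact: computable_nth.
by do 2! apply: computable_nth_behead; apply: computable_nth.
Qed.

Lemma computable_sub n f g : computable n f -> computable n g ->
  computable n (fun o xs => f o xs - g o xs).
Proof.
have predP : computable 1 (fun _ xs => (nth 0 xs 0).-1).
  apply: (@computable_ext _ (fun _ xs => iteri (nth 0 xs 0) (fun i _ => i) 0)).
    by move=> o xs; case: (nth 0 xs 0).
  apply: computable_iteri; [exact: computable_nth | exact: computable_const |].
  exact: computable_nth.
apply: (@computable_comp2 n (fun _ => subn)).
apply: (@computable_ext _
  (fun _ xs => iteri (nth 0 xs 1) (fun _ => predn) (nth 0 xs 0))).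
  move=> o xs; elim: (nth 0 xs 1) => [|m /= ->]; first by rewrite subn0.
  by rewrite subnS.
apply: computable_iteri; try exact: computable_nth.
apply: (@computable_comp1 _ (fun _ => predn) _ predP); exact: computable_nth.
Qed.

Lemma computable_fact n f : computable n f -> computable n (fun o xs => (f o xs)`!).
Proof.
apply: (@computable_comp1 n (fun _ => factorial)).
apply: (@computable_ext _
  (fun _ xs => iteri (nth 0 xs 0) (fun i z => i.+1 * z) 1)).
  by move=> o xs; elim: (nth 0 xs 0) => //= m ->.
apply: computable_iteri; [exact: computable_nth | exact: computable_const |].
by apply: computable_mul; [apply: computable_succ|]; apply: computable_nth.
Qed.

Lemma computable_leq n f g : computable n f -> computable n g ->
  computable n (fun o xs => f o xs <= g o xs).
Proof.
move=> fP gP; apply: (@computable_ext _ (fun o xs => 1 - (f o xs - g o xs))).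
  by move=> o xs; lia.
by do ?apply: computable_sub => //; apply: computable_const.
Qed.

Lemma computable_neg n (P : (nat -> nat -> nat) -> seq nat -> bool) :
  computable n (fun o xs => P o xs) -> computable n (fun o xs => ~~ P o xs).
Proof.
move=> pP; apply: (@computable_ext _ (fun o xs => 1 - P o xs)).
  by move=> o xs; case: (P o xs).
by apply: computable_sub pP; apply: computable_const.
Qed.

Lemma computable_and n (P Q : (nat -> nat -> nat) -> seq nat -> bool) :
  computable n (fun o xs => P o xs) -> computable n (fun o xs => Q o xs) ->
  computable n (fun o xs => P o xs && Q o xs).
Proof.
move=> pP qP; apply: (@computable_ext _ (fun o xs => P o xs * Q o xs)).
  by move=> o xs; case: (P o xs); case: (Q o xs).
exact: computable_mul.
Qed.

Lemma computable_or n (P Q : (nat -> nat -> nat) -> seq nat -> bool) :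
  computable n (fun o xs => P o xs) -> computable n (fun o xs => Q o xs) ->
  computable n (fun o xs => P o xs || Q o xs).
Proof.
move=> pP qP; apply: (@computable_ext _ (fun o xs => ~~ (~~ P o xs && ~~ Q o xs))).
  by move=> o xs; case: (P o xs); case: (Q o xs).
by apply: computable_neg; apply: computable_and; apply: computable_neg.
Qed.

Lemma computable_if n (P : (nat -> nat -> nat) -> seq nat -> bool) f g :
  computable n (fun o xs => P o xs) -> computable n f -> computable n g ->
  computable n (fun o xs => if P o xs then f o xs else g o xs).
Proof.
move=> pP fP gP.
apply: (@computable_ext _ (fun o xs => P o xs * f o xs + (~~ P o xs) * g o xs)).
  by move=> o xs; case: (P o xs); lia.
by apply: computable_add; apply: computable_mul => //; apply: computable_neg.
Qed.

Lemma computable_sum n h (F : (nat -> nat -> nat) -> seq nat -> nat -> nat) :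
  computable n h ->
  computable n.+1 (fun o xs => F o (behead xs) (nth 0 xs 0)) ->
  computable n (fun o xs => \sum_(i < h o xs) F o xs i).
Proof.
move=> hP FP.
apply: (@computable_ext _
  (fun o xs => iteri (h o xs) (fun i z => z + F o xs i) 0)).
  move=> o xs; elim: (h o xs) => [|m IH]; first by rewrite big_ord0.
  by rewrite /= IH big_ord_recr.
apply: computable_iteri; [by [] | exact: computable_const |].
apply: computable_add; first exact: computable_nth.
(* [F] expects the index followed by the parameters, so the accumulator at index 1 is dropped. *)
case: FP => p pP; exists (Comp p (Proj 0 :: [seq Proj i.+2 | i <- iota 0 n])).
move=> o xs szx.
have szb : size (behead (behead xs)) = n by rewrite !size_behead szx.
apply: (@eval_comp _ _ _ _ (nth 0 xs 0 :: behead (behead xs))).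
- by rewrite /= size_map size_iota szb.
- move=> [|i] //=; rewrite size_map size_iota ltnS => lti.
  by rewrite (nth_map 0) ?size_iota // nth_iota //= !nth_behead.
by have := pP o (nth 0 xs 0 :: behead (behead xs)); rewrite /= szb; apply.
Qed.

Lemma computable_all n h (P : (nat -> nat -> nat) -> seq nat -> nat -> bool) :
  computable n h ->
  computable n.+1 (fun o xs => P o (behead xs) (nth 0 xs 0)) ->
  computable n (fun o xs => all (P o xs) (iota 0 (h o xs))).
Proof.
move=> hP PP.
apply: (@computable_ext _
  (fun o xs => (\sum_(i < h o xs) (~~ P o xs i : nat) <= 0))).
  move=> o xs; elim: (h o xs) => [|m IH]; first by rewrite big_ord0.
  rewrite big_ord_recr -[in RHS]addn1 iotaD all_cat /= andbT add0n.
  rewrite [X in X + _](_ : _ = \sum_(i < m) (~~ P o xs i : nat)) //.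
  by move: IH; move: (\sum_(i < m) _) => c; case: (all _ _); case: (P o xs m); lia.
apply: computable_leq; last exact: computable_const.
apply: (@computable_sum _ _ (fun o xs i => ~~ P o xs i : nat)) => //.
exact: computable_neg.
Qed.

Lemma computable_has n h (P : (nat -> nat -> nat) -> seq nat -> nat -> bool) :
  computable n h ->
  computable n.+1 (fun o xs => P o (behead xs) (nth 0 xs 0)) ->
  computable n (fun o xs => has (P o xs) (iota 0 (h o xs))).
Proof.
move=> hP PP.
apply: (@computable_ext _
  (fun o xs => ~~ all (fun i => ~~ P o xs i) (iota 0 (h o xs)))).
  by move=> o xs; rewrite -has_predC; congr nat_of_bool; apply: eq_has => i /=;
    rewrite negbK.
apply/computable_neg/(@computable_all _ _ (fun o xs i => ~~ P o xs i)) => //.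
exact: computable_neg.
Qed.

Lemma computable_div n f g : computable n f -> computable n g ->
  computable n (fun o xs => f o xs %/ g o xs).
Proof.
apply: (@computable_comp2 n (fun _ => divn)).
(* The quotient of m by d counts the i < m with (i + 1) d <= m; the first factor makes division by 0
   give 0. *)
apply: (@computable_ext _ (fun _ xs => (1 <= nth 0 xs 1) *
    \sum_(i < nth 0 xs 0) (i.+1 * nth 0 xs 1 <= nth 0 xs 0))).
  move=> o xs; move: (nth 0 xs 0) (nth 0 xs 1) => m d.
  have [->|d0] := posnP d; first by rewrite mul0n divn0.
  rewrite mul1n; under eq_bigr do rewrite -leq_divRL //.
  have := leq_div m d; move: (m %/ d) => c.
  suff -> : \sum_(i < m) (i < c) = minn m c by lia.
  elim: m => [|m IH]; first by rewrite big_ord0 min0n.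
  by rewrite big_ord_recr /= IH; lia.
apply: computable_mul.
  by apply: computable_leq; [apply: computable_const | apply: computable_nth].
apply: (@computable_sum _ _
  (fun _ xs i => (i.+1 * nth 0 xs 1 <= nth 0 xs 0))); first exact: computable_nth.
apply: computable_leq; last by apply: computable_nth_behead; apply: computable_nth.
apply: computable_mul; first by apply: computable_succ; apply: computable_nth.
by apply: computable_nth_behead; apply: computable_nth.
Qed.

Lemma computable_mod n f g : computable n f -> computable n g ->
  computable n (fun o xs => f o xs %% g o xs).
Proof.
move=> fP gP.
apply: (@computable_ext _ (fun o xs => f o xs - f o xs %/ g o xs * g o xs)).
  by move=> o xs; rewrite {1}(divn_eq (f o xs) (g o xs)) addKn.
by apply: computable_sub => //; apply: computable_mul => //; apply: computable_div.
Qed.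

(** [CodeSeq.code] folds from the right, so the iteration prepends the entries in reverse order, the
    last one first. *)
Lemma code_mkseq f n : CodeSeq.code (mkseq f n) =
  iteri n (fun r c => 2 ^ f (n - r.+1) * (c * 2).+1) 0.
Proof.
suff H r : r <= n -> CodeSeq.code [seq f j | j <- iota (n - r) r] =
    iteri r (fun r c => 2 ^ f (n - r.+1) * (c * 2).+1) 0.
  by have := H n (leqnn n); rewrite subnn.
elim: r => [|r IH] //= ltrn.
rewrite -IH ?(ltnW ltrn) // muln2.
by have -> : n - r = (n - r.+1).+1 by lia.
Qed.

Lemma computable_code_mkseq n h (F : (nat -> nat -> nat) -> seq nat -> nat -> nat) :
  computable n h ->
  computable n.+1 (fun o xs => F o (behead xs) (nth 0 xs 0)) ->
  computable n (fun o xs => CodeSeq.code (mkseq (F o xs) (h o xs))).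
Proof.
move=> hP FP.
apply: (@computable_ext _ (fun o xs =>
    iteri (h o xs) (fun r c => 2 ^ F o xs (h o xs - r.+1) * (c * 2).+1) 0)).
  by move=> o xs; rewrite code_mkseq.
apply: computable_iteri; [by [] | exact: computable_const |].
apply: computable_mul; last first.
  apply: computable_succ; apply: computable_mul; last exact: computable_const.
  exact: computable_nth.
apply: computable_exp; first exact: computable_const.
have hP2 := computable_shift _ _ (computable_shift _ _ hP).
have dP : computable n.+2
    (fun o xs => h o (behead (behead xs)) - (nth 0 xs 0).+1).
  by apply: computable_sub => //; apply: computable_succ; apply: computable_nth.
case: FP => p pP; case: dP => d dP.
exists (Comp p (d :: [seq Proj i.+2 | i <- iota 0 n])) => o xs szx.
have szb : size (behead (behead xs)) = n by rewrite !size_behead szx.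
apply: (@eval_comp _ _ _ _
  (h o (behead (behead xs)) - (nth 0 xs 0).+1 :: behead (behead xs))).
- by rewrite /= size_map size_iota szb.
- move=> [|i] /=; first by move=> _; apply: dP.
  rewrite size_map size_iota ltnS => lti.
  by rewrite (nth_map 0) ?size_iota // nth_iota //= !nth_behead.
by apply: (pP o (_ :: _)); rewrite /= szb.
Qed.

(** Follows the head symbol of the body; what it does not recognize is left as a goal. *)
Ltac computability :=
  lazymatch goal with
  | |- computable _ ?f =>
    lazymatch f with
    | fun _ _ => ?c => exact: computable_const
    | _ => lazymatch f with
    | (fun o xs => nth _ xs _) => exact: computable_nth
    | (fun o xs => nth _ (behead _) _) =>
        apply: computable_nth_behead; computability
    | (fun o xs => o _ _) => apply: computable_query; computability
    | (fun o xs => S _) => apply: computable_succ; computability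
    | (fun o xs => addn _ _) => apply: computable_add; computability
    | (fun o xs => muln _ _) => apply: computable_mul; computability
    | (fun o xs => expn _ _) => apply: computable_exp; computability
    | (fun o xs => subn _ _) => apply: computable_sub; computability
    | (fun o xs => factorial _) => apply: computable_fact; computability
    | (fun o xs => divn _ _) => apply: computable_div; computability
    | (fun o xs => modn _ _) => apply: computable_mod; computability
    | (fun o xs => nat_of_bool (leq _ _)) => apply: computable_leq; computability
    | (fun o xs => nat_of_bool (negb _)) => apply: computable_neg; computability
    | (fun o xs => nat_of_bool (andb _ _)) => apply: computable_and; computability
    | (fun o xs => nat_of_bool (orb _ _)) => apply: computable_or; computability
    | (fun o xs => nat_of_bool (all _ _)) => apply: computable_all; computability
    | (fun o xs => nat_of_bool (has _ _)) => apply: computable_has; computability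
    | (fun o xs => if _ then _ else _) => apply: computable_if; computability
    | (fun o xs => CodeSeq.code (mkseq _ _)) =>
        apply: computable_code_mkseq; computability
    | (fun o xs => iteri _ _ _) => apply: computable_iteri; computability
    | _ => idtac
    end end
  end.

(** * Exhaustive search over tables *)

(** In integers [m < y] means m + 1 <= y: the move covers the whole cell, not just a point of it. *)
Definition crosses (m x y : nat) : bool := (x <= m < y) || (y <= m < x).

(* [x i j] is the position of agent [i] at time [j], with [j] taken modulo
   [P]; cell [m] is the segment between the points [m] and [m + 1]. *)
Definition valid (k P W : nat) (q : nat -> nat) (x : nat -> nat -> nat)
    (M : nat) : bool :=
  all (fun i => all (fun j => (x i (j.+1 %% P) <= x i j + q i) &&
                              (x i j <= x i (j.+1 %% P) + q i))
    (iota 0 P)) (iota 0 k) &&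
  all (fun m => all (fun j => has (fun i => has (fun r =>
      crosses m (x i ((j + r) %% P)) (x i ((j + r).+1 %% P)))
    (iota 0 W)) (iota 0 k)) (iota 0 P)) (iota 0 M.+1).

(** A table is stored as one number in base [b], row by row, so that searching through tables is
    searching through numbers. *)
Definition digit (b N j : nat) : nat := N %/ b ^ j %% b.

Definition table (b P N i j : nat) : nat := digit b N (i * P + j).

(* Points visited by the same agent within time [T] are at distance at most
   [v T], so [k] agents cannot visit [k + 1] points further apart than that. *)
Definition bound (o : nat -> nat -> nat) (k n : nat) : nat :=
  k * ((\sum_(i < k) (o i.+2 n).+1) * (o 0 n).+1 + 1) + 2.

(** For [k] agents with positions below [b] there are [b ^ (k * W.+1)] windows of [W.+1] positions;
    the factorial is a multiple of every positive distance up to that number. *)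
Definition period (b k W : nat) : nat := (b ^ (k * W.+1))`!.

(** The quotient of [s] is the topmost cell and the remainder is the table, so a larger index never
    means a shorter fence. Subtracting 1 from a speed absorbs the error of its approximation;
    subtracting 2 from the idle time leaves one further step. *)
Definition valid_index (o : nat -> nat -> nat) (k n b P s : nat) : bool :=
  valid k P (o 0 n - 2) (fun i => o i.+2 n - 1)
    (table b P (s %% b ^ (k * P))) (s %/ b ^ (k * P)).

(** The range admits every topmost cell below [b]; later successes overwrite earlier ones. *)
Definition last_index (o : nat -> nat -> nat) (k n b P : nat) : nat :=
  iteri (b * b ^ (k * P)) (fun s z => if valid_index o k n b P s then s else z) 0.

(** Lengths are in units of 1 / D^2 with D = 2^n, and a step lasts D / D^2 = 1 / D. *)
Definition output (o : nat -> nat -> nat) (k n b P : nat) : description :=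
  Description (2 ^ (n + n)) (2 ^ n)
    (mkseq (fun i => mkseq (table b P (last_index o k n b P %% b ^ (k * P)) i) P) k).

Lemma computable_valid_index : computable 5 (fun o xs => valid_index o
  (nth 0 xs 0) (nth 0 xs 1) (nth 0 xs 2) (nth 0 xs 3) (nth 0 xs 4)).
Proof. by rewrite /valid_index /valid /crosses /table /digit; computability. Qed.

Lemma computable_last_index : computable 4 (fun o xs => last_index o
  (nth 0 xs 0) (nth 0 xs 1) (nth 0 xs 2) (nth 0 xs 3)).
Proof.
rewrite /last_index; computability.
(* The iteration puts counter and accumulator before the four parameters; [valid_index] takes the
   counter last. *)
pose v i := fun (_ : nat -> nat -> nat) xs => nth 0 xs i.
apply: (computable_ext _ _ _ _ (computable_subst 6 5 _
  [:: v 2; v 3; v 4; v 5; v 0] erefl computable_valid_index _)).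
  by move=> o xs; rewrite /= /v !nth_behead.
by do !split; apply: computable_nth.
Qed.

Lemma computable_output : computable 4 (fun o xs => encode (output o
  (nth 0 xs 0) (nth 0 xs 1) (nth 0 xs 2) (nth 0 xs 3))).
Proof.
pose v i := fun (_ : nat -> nat -> nat) xs => nth 0 xs i.
(* This is [encode] unfolded, with the last index as argument 0 and [k], [n], [b], [P] after it. *)
have step : computable 5 (fun o xs => 2 ^ (2 ^ (nth 0 xs 2 + nth 0 xs 2)) *
    (2 ^ (2 ^ nth 0 xs 2) * (CodeSeq.code (mkseq (fun i =>
      CodeSeq.code (mkseq (table (nth 0 xs 3) (nth 0 xs 4)
        (nth 0 xs 0 %% nth 0 xs 3 ^ (nth 0 xs 1 * nth 0 xs 4)) i)
        (nth 0 xs 4))) (nth 0 xs 1)) * 2).+1 * 2).+1).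
  by rewrite /table /digit; computability.
apply: (computable_ext _ _ _ _ (computable_subst 4 5 _
  [:: fun o xs => last_index o (v 0 o xs) (v 1 o xs) (v 2 o xs) (v 3 o xs);
      v 0; v 1; v 2; v 3] erefl step _)).
  move=> o xs; rewrite /v /= /encode /= !muln2 /mkseq -map_comp.
  by [].
by do !split; [apply: computable_last_index | apply: computable_nth ..].
Qed.

Definition answer (o : nat -> nat -> nat) (k n : nat) : description :=
  let b := bound o k n in output o k n b (period b k (o 0 n - 2)).

Lemma computable_bound :
  computable 2 (fun o xs => bound o (nth 0 xs 0) (nth 0 xs 1)).
Proof.
rewrite /bound; computability.
apply: (@computable_sum _ _ (fun o xs i => (o i.+2 (nth 0 xs 1)).+1));
  computability.
Qed.

Lemma computable_answer :
  computable 2 (fun o xs => encode (answer o (nth 0 xs 0) (nth 0 xs 1))).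
Proof.
pose v i := fun (_ : nat -> nat -> nat) xs => nth 0 xs i.
apply: (computable_ext _ _ _ _ (computable_subst 2 4 _
  [:: v 0; v 1; fun o xs => bound o (v 0 o xs) (v 1 o xs);
      fun o xs => period (bound o (v 0 o xs) (v 1 o xs)) (v 0 o xs)
                    (o 0 (v 1 o xs) - 2)] erefl computable_output _)) => //.
do !split; try exact: computable_nth; first exact: computable_bound.
by rewrite /period /v; computability; apply: computable_bound.
Qed.

(* The threshold 200 E^2, with E = 2^e, is what [window_fits] and [speed_fits]
   require. *)
Definition precise (o : nat -> nat -> nat) (k e n : nat) : bool :=
  (200 * (2 ^ e * 2 ^ e) <= o 0 n) &&
  all (fun i => 200 * (2 ^ e * 2 ^ e) <= o i.+2 n) (iota 0 k).

(** Two unbounded searches, which the hypotheses make succeed. The first finds [e] with [o 1 e] at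
    least 2; for an approximation of eps this forces eps >= 2^-e, so E = [2 ^ e.+1] has 1 / E < eps.
    The second finds a precision [n] fit for E. *)
Lemma program_of_answer : exists p : program, forall o k,
  (exists e, 2 <= o 1 e) -> (forall e, exists n, precise o k e n) ->
  exists e n, [/\ 2 <= o 1 e, precise o k e.+1 n &
    eval o p [:: k] (encode (answer o k n))].
Proof.
have [pe peP] : exists p, forall o xs, size xs = 1 ->
    (exists e, 2 <= o 1 e) -> exists e, 2 <= o 1 e /\ eval o p xs e.
  by apply: (@computable_mu 1 (fun o e xs => 2 <= o 1 e)); computability.
have [pn pnP] : exists p, forall o xs, size xs = 2 ->
    (exists n, precise o (nth 0 xs 0) (nth 0 xs 1).+1 n) ->
    exists n, precise o (nth 0 xs 0) (nth 0 xs 1).+1 n /\ eval o p xs n.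
  apply: (@computable_mu 2 (fun o n xs => precise o (nth 0 xs 0) (nth 0 xs 1).+1 n)).
  by rewrite /precise; computability.
have [pa paP] := computable_answer.
exists (Comp pa [:: Proj 0; Comp pn [:: Proj 0; pe]]) => o k exe exn.
have [e [eP ee]] := peP o [:: k] erefl exe.
have [n [nP en]] := pnP o [:: k; e] erefl (exn e.+1).
exists e, n; split=> //.
apply: (@eval_comp _ _ _ _ [:: k; n]) => //; last exact: (paP o [:: k; n]).
case=> [|[|]] // _; apply: (@eval_comp _ _ _ _ [:: k; e]) => //.
by case=> [|[|]].
Qed.

(** * Periodic tables of positions *)

Lemma iteri_last (P : pred nat) Q s : s < Q -> P s ->
  let z := iteri Q (fun s z => if P s then s else z) 0 in P z && (s <= z).
Proof.
move=> + Ps; elim: Q => //= Q IH; rewrite ltnS leq_eqVlt => /orP[/eqP<-|/IH].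
  by rewrite Ps Ps leqnn.
move=> /andP[Pz sz]; case: ifP => [PQ|_]; last by rewrite Pz.
rewrite PQ (leq_trans sz) //.
(* An iterate never exceeds the number of rounds. *)
by elim: (Q) => //= m IHm; case: ifP => // _; rewrite (leq_trans IHm).
Qed.

Lemma digits_exist b n (f : nat -> nat) : (forall j, j < n -> f j < b) ->
  exists2 N, N < b ^ n & forall j, j < n -> digit b N j = f j.
Proof.
elim: n => [|n IH] fb; first by exists 0.
have [j /ltnW|N ltN NP] := IH; first exact: fb.
have b0 : 0 < b by apply: leq_ltn_trans (fb n _).
have bn0 : 0 < b ^ n by rewrite expn_gt0 b0.
have fn := fb n (ltnSn n).
exists (f n * b ^ n + N).
  have : (f n).+1 * b ^ n <= b * b ^ n by rewrite leq_mul2r fn orbT.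
  by rewrite expnS mulSn; lia.
move=> j; rewrite ltnS leq_eqVlt => /orP[/eqP->|ltj].
  by rewrite /digit divnMDl // divn_small // addn0 modn_small.
(* For [j < n] the new leading term is a multiple of [b * b ^ j], which digit [j] does not see. *)
have -> : f n * b ^ n = f n * b ^ (n - j.+1) * b * b ^ j.
  by rewrite -!mulnA -expnS -expnD; congr (_ * b ^ _); lia.
by rewrite -(NP j ltj) /digit divnMDl ?expn_gt0 ?b0 // modnMDl.
Qed.

Lemma pigeonhole (A : finType) (f : nat -> A) :
  exists i j, [/\ i < j, j <= #|A| & f i = f j].
Proof.
have /injectivePn[i [j nij fij]] : ~~ injectiveb (fun i : 'I_#|A|.+1 => f i).
  by apply/negP => /injectiveP/leq_card; rewrite card_ord ltnn.
have [lt|gt|/val_inj eqij] := ltngtP i j.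
- by exists i, j; split=> //; rewrite -ltnS.
- by exists j, i; split=> //; rewrite -ltnS.
by rewrite eqij eqxx in nij.
Qed.

Lemma period_gt0 b k W : 0 < period b k W.
Proof. exact: fact_gt0. Qed.

(* If the windows of length [W + 1] at times [u < u + p] agree, then repeating
   the part in between forever creates no new window. *)
Lemma periodize k b W (w : nat -> nat -> nat) : 0 < k ->
  (forall i j, i < k -> w i j < b) ->
  exists x : nat -> nat -> nat,
    (forall i j, x i (j %% period b k W) = x i j) /\
    forall j, exists j', forall i r, i < k -> r <= W -> x i (j + r) = w i (j' + r).
Proof.
move=> k0; case: b => [|b] wb; first by have := wb 0 0 k0.
(* A window is a function from [k * W.+1] places to [b.+1] values, so two windows agree at times
   bounded by the number of such functions. *)
have [u [u' [ltu leu eqw]]] := pigeonhole _ (fun j =>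
  [ffun z : 'I_k * 'I_W.+1 => inord (w z.1 (j + z.2)) : 'I_b.+1]).
have {}eqw i r : i < k -> r <= W -> w i (u + r) = w i (u' + r).
  move=> ltik; rewrite -ltnS => ltrW.
  move/ffunP/(_ (Ordinal ltik, Ordinal ltrW)): eqw; rewrite !ffunE /=.
  by move/(congr1 (@nat_of_ord _)); rewrite !inordK // wb.
move: leu; rewrite card_ffun card_prod !card_ord => leu.
pose p := u' - u; have p0 : 0 < p by rewrite subn_gt0.
exists (fun i j => w i (u + j %% p)); split=> [i j|j].
  (* [p] is positive and at most the number of windows, so it divides the factorial. *)
  by rewrite modn_dvdm // dvdn_fact // p0 (leq_trans (leq_subr _ _)).
exists (u + j %% p) => i r ltik lerW.
rewrite -[RHS]/(w i (u + j %% p + r)) -(modnDml j r) -addnA.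
have : j %% p + r < p + W.+1 by have := ltn_pmod j p0; lia.
(* An offset [y >= p] has [y - p <= W], so it can be moved back by [p] inside the window where the
   two copies agree. *)
elim/ltn_ind: (_ + r) => y IH lty.
have [ltyp|lepy] := ltnP y p; first by rewrite modn_small.
have -> : u + y = u' + (y - p) by rewrite /p; lia.
rewrite -eqw //; last by lia.
have <- := IH (y - p); [|lia..].
by rewrite -{1}(subnK lepy) modnDr.
Qed.

Lemma validP k P W q x M : reflect
  ((forall i j, i < k -> j < P -> x i (j.+1 %% P) <= x i j + q i /\
                                  x i j <= x i (j.+1 %% P) + q i) /\
   (forall m j, m <= M -> j < P -> exists i r, [/\ i < k, r < W &
      crosses m (x i ((j + r) %% P)) (x i ((j + r).+1 %% P))]))
  (valid k P W q x M).
Proof.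
apply: (iffP andP) => -[st cr]; split.
- move=> i j ltik ltjP; apply/andP.
  by move/allP/(_ i): st; rewrite mem_iota => /(_ ltik)/allP/(_ j); rewrite mem_iota;
    apply.
- move=> m j lem ltj.
  move/allP/(_ m): cr; rewrite mem_iota => /(_ lem)/allP/(_ j).
  rewrite mem_iota => /(_ ltj) /hasP[i]; rewrite mem_iota => ltik /hasP[r].
  by rewrite mem_iota => ltr; exists i, r.
- apply/allP => i; rewrite mem_iota => ltik; apply/allP => j; rewrite mem_iota => ltj.
  exact/andP/st.
apply/allP => m; rewrite mem_iota => lem; apply/allP => j; rewrite mem_iota => ltj.
have [i [r [ltik ltr cri]]] := cr m j lem ltj.
apply/hasP; exists i; rewrite ?mem_iota //.
by apply/hasP; exists r; rewrite ?mem_iota.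
Qed.

(** Both conditions see only windows of [W.+1] consecutive positions. Those of the periodized
    sequence all occur in [w], and one period of it is written as a number in base [b]. *)
Lemma valid_table_exists k b W q (w : nat -> nat -> nat) M : 0 < k -> 0 < W ->
  (forall i j, i < k -> w i j < b) ->
  (forall i j, i < k -> w i j.+1 <= w i j + q i /\ w i j <= w i j.+1 + q i) ->
  (forall m j, m <= M -> exists i r, [/\ i < k, r < W &
      crosses m (w i (j + r)) (w i (j + r).+1)]) ->
  exists2 N, N < b ^ (k * period b k W) &
    valid k (period b k W) W q (table b (period b k W) N) M.
Proof.
move=> k0 W0 wb wst wcr; have [x [xper xwin]] := periodize _ _ W _ k0 wb.
have P0 := period_gt0 b k W; move: (period b k W) P0 xper => P P0 xper.
have [y|N ltN NP] := digits_exist b (k * P) (fun y => x (y %/ P) (y %% P)).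
  rewrite -ltn_divLR // => ltik.
  by have [j' /(_ _ 0 ltik isT)] := xwin (y %% P); rewrite addn0 => ->; apply: wb.
have tabE i j : i < k -> table b P N i (j %% P) = x i j.
  move=> ltik; have ltj := ltn_pmod j P0.
  rewrite /table NP; last first.
    by rewrite -ltn_divLR // divnMDl // divn_small // addn0.
  by rewrite divnMDl // divn_small // addn0 modnMDl modn_mod xper.
exists N => //; apply/validP; split=> [i j ltik ltj|m j lem ltj].
  rewrite -{2 3}(modn_small ltj) !tabE //.
  have [j' jP] := xwin j; have := jP i 0 ltik isT; have := jP i 1 ltik W0.
  by rewrite !addn0 !addn1 => -> ->; apply: wst.
have [j' jP] := xwin j; have [i [r [ltik ltr cr]]] := wcr m j' lem.
exists i, r; split=> //; rewrite !tabE // -addnS !jP //; last exact: ltnW.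
by rewrite addnS.
Qed.

Lemma last_index_valid o k n b P s : s < b * b ^ (k * P) ->
  valid_index o k n b P s ->
  valid_index o k n b P (last_index o k n b P) /\ s <= last_index o k n b P.
Proof. by move=> lts vs; apply/andP; apply: iteri_last. Qed.

(** A discrete intermediate value theorem: a step on which the sequence passes between values at
    most [m] and values above [m] covers the whole cell, whichever of the two times is earlier. *)
Lemma crosses_between (w : nat -> nat) m j1 j2 : w j1 <= m -> m < w j2 ->
  exists j, [/\ minn j1 j2 <= j, j < maxn j1 j2 & crosses m (w j) (w j.+1)].
Proof.
move=> w1 w2; have [le12|le21] := leqP j1 j2.
  elim: j2 le12 w2 => [|j2 IH]; first by case: j1 w1 => //; lia.
  rewrite leq_eqVlt => /orP[/eqP<-|]; first by lia.
  rewrite ltnS => le12 w2; have [lt|ge] := ltnP m (w j2).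
    by have [j [? ? ?]] := IH le12 lt; exists j; split=> //; lia.
  by exists j2; split; rewrite /crosses; lia.
elim: j1 le21 w1 => // j1 IH; rewrite ltnS => le21 w1.
have [ge|lt] := leqP (w j1) m; last by exists j1; split; rewrite /crosses; lia.
have [eq21|ne21] := eqVneq j2 j1; first by rewrite eq21 in w2; lia.
have [|j [? ? ?]] := IH _ ge; first by lia.
by exists j; split=> //; lia.
Qed.

(** * Schedules described by tables *)

Local Open Scope ring_scope.

Definition interpolate (R : realType) (g : int -> R) (s : R) : R :=
  (1 - (s - (Num.floor s)%:~R)) * g (Num.floor s) +
  (s - (Num.floor s)%:~R) * g (Num.floor s + 1).

(** The end [r = 1] is included: the floor jumps there, but both formulas give [g (j + 1)]. *)
Lemma interpolate_intD (R : realType) (g : int -> R) (j : int) (r : R) :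
  0 <= r <= 1 ->
  interpolate R g (j%:~R + r) = (1 - r) * g j + r * g (j + 1).
Proof.
move=> /andP[r0]; rewrite le_eqVlt => /orP[/eqP->|r1].
  have fl : Num.floor (j%:~R + 1 : R) = j + 1.
    by apply: floor_def; rewrite !intrD; lra.
  by rewrite /interpolate fl !intrD /= subrr; ring.
have fl : Num.floor (j%:~R + r) = j by apply: floor_def; rewrite intrD; lra.
by rewrite /interpolate fl; ring.
Qed.

Lemma dist_int_lipschitz (R : realType) (g : int -> R) (q : R) :
  (forall j, `|g (j + 1) - g j| <= q) ->
  forall j l : int, j <= l -> `|g l - g j| <= q * (l - j)%:~R.
Proof.
move=> gq j l le_jl; have -> : l = j + `|l - j|%N by lia.
elim: `|l - j|%N => [|m IH].
  by rewrite addr0 !subrr normr0 mulr0.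
have -> : j + m.+1 = j + m + 1 :> int by lia.
have -> : j + m + 1 - j = (j + m - j) + 1 :> int by lia.
rewrite [(_ + 1)%:~R]intrD mulrDr mulr1.
rewrite [g _ - g j](_ : _ = (g (j + m + 1) - g (j + m)) + (g (j + m) - g j)).
  by rewrite (le_trans (ler_normD _ _)) // addrC lerD.
by ring.
Qed.

Lemma interpolate_lipschitz (R : realType) (g : int -> R) (q : R) :
  (forall j, `|g (j + 1) - g j| <= q) ->
  forall s t : R, `|interpolate R g s - interpolate R g t| <= q * `|s - t|.
Proof.
move=> gq s t; have q0 : 0 <= q by apply: le_trans (gq 0).
wlog le_st : s t / s <= t => [hw|].
  by have [/hw//|/ltW/hw] := leP s t; rewrite distrC [`|t - s|]distrC.
rewrite distrC (distrC s) [`|t - s|]ger0_norm ?subr_ge0 //.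
have /andP[s1 s2] := floor_itv s; have /andP[t1 t2] := floor_itv t.
have /le_floor := le_st; rewrite /interpolate.
move: (Num.floor s) (Num.floor t) s1 s2 t1 t2 => j l; rewrite !intrD /= => s1 s2 t1 t2.
rewrite le_eqVlt => /orP[/eqP eqjl|ltjl].
  have := gq j; rewrite eqjl; set d := g _ - _ => dq.
  rewrite [X in `|X|](_ : _ = (t - s) * d); last by rewrite /d; ring.
  by rewrite normrM ger0_norm ?subr_ge0 // mulrC ler_wpM2r // subr_ge0.
(* The times lie in different steps: the increment is split at the nodes [j + 1] and [l]. *)
have lejl : j + 1 <= l by lia.
have := dist_int_lipschitz _ _ _ gq _ _ lejl.
rewrite !intrD !mulrNz !intrD /= => H.
have := gq j; have := gq l; move: H.
rewrite !ler_norml => /andP[? ?] /andP[? ?] /andP[? ?].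
apply/andP; split; nra.
Qed.

Lemma interpolate_hits (R : realType) (g : int -> nat) (j : int) (m : nat) (y : R) :
  crosses m (g j) (g (j + 1)) -> m%:R <= y <= m.+1%:R ->
  exists r : R, 0 <= r <= 1 /\ interpolate R (fun j => (g j)%:R) (j%:~R + r) = y.
Proof.
move=> cr /andP[my ym].
pose x := (g j)%:R : R; pose z := (g (j + 1))%:R : R.
have nzx : z - x != 0.
  by rewrite subr_eq0 eqr_nat; move: cr; rewrite /crosses; lia.
have r01 : 0 <= (y - x) / (z - x) <= 1.
  have mS : m%:R < m.+1%:R :> R by rewrite ltr_nat.
  case/orP: cr => /andP[]; rewrite -!(ler_nat R) => ? ?.
    have zx : 0 < z - x by rewrite /x /z; lra.
    rewrite ler_pdivlMr // mul0r ler_pdivrMr // mul1r /x /z; lra.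
  have zx : z - x < 0 by rewrite /x /z; lra.
  rewrite ler_ndivlMr // mul0r ler_ndivrMr // mul1r /x /z; lra.
exists ((y - x) / (z - x)); split=> //.
by rewrite interpolate_intD // -/x -/z; field.
Qed.

Lemma absz_modz_lt (P : nat) (j : int) : (0 < P)%N -> (`|(j %% P)%Z| < P)%N.
Proof. by move=> P0; have := @ltz_pmod j P; have := @modz_ge0 j P; lia. Qed.

Lemma cyclic_nth_mkseq (f : nat -> nat) (P : nat) (j : int) (r : nat) : (0 < P)%N ->
  cyclic_nth (mkseq f P) (j + r) = f ((`|(j %% P)%Z| + r) %% P)%N.
Proof.
move=> P0; rewrite /cyclic_nth size_mkseq.
have -> : ((j + r) %% P)%Z = ((`|(j %% P)%Z| + r) %% P)%N.
  rewrite -modzDml -modz_nat PoszD gez0_abs //.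
  by apply: modz_ge0; lia.
by rewrite absz_nat nth_mkseq // ltn_pmod.
Qed.

Lemma schedule_ofE (R : realType) (k : nat) (d : description) (i : 'I_k) (t : R) :
  schedule_of R k d i t =
  interpolate R (fun j => (cyclic_nth (nth [::] (waypoints d) i) j)%:R)
    (t / ((step d)%:R / (den d)%:R)) / (den d)%:R.
Proof. by []. Qed.

(** A window starting off the grid waits less than one step for the next grid time, and [W] steps
    then suffice; hence [W.+1] steps must fit into [T]. A change of [q i] units per step is the
    speed q / S. *)
Lemma valid_schedule (R : realType) (k : nat) (v : 'I_k -> R) (T : R)
    (D S P W M : nat) (q : nat -> nat) (x : nat -> nat -> nat) :
  (0 < P)%N -> (0 < D)%N -> (0 < S)%N -> valid k P W q x M ->
  (forall i : 'I_k, (q i)%:R <= v i * S%:R) ->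
  W.+1%:R * (S%:R / D%:R) <= T ->
  let d := Description D S (mkseq (fun i => mkseq (x i) P) k) in
  is_schedule v (schedule_of R k d) /\
  patrols (schedule_of R k d) (M.+1%:R / D%:R) T.
Proof.
move=> P0 D0 S0 /validP[st cr] qv WT d.
have D0' : 0 < D%:R :> R by rewrite ltr0n.
have S0' : 0 < S%:R :> R by rewrite ltr0n.
have sg0 : 0 < S%:R / D%:R :> R by rewrite divr_gt0.
have wE (i : 'I_k) : nth [::] (waypoints d) i = mkseq (x i) P.
  by rewrite nth_mkseq.
split=> [i s t|t y /andP[y0 yM]].
  rewrite !schedule_ofE wE; set g := fun j : int => _.
  have gq j : `|g (j + 1) - g j| <= (q i)%:R.
    have ltj0 := absz_modz_lt _ j P0.
    have gj : g j = g (j + 0%N) by rewrite addr0.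
    rewrite gj /g (cyclic_nth_mkseq _ _ j 0) // (cyclic_nth_mkseq _ _ j 1) //.
    rewrite addn0 addn1 (modn_small ltj0).
    have [] := st i _ (ltn_ord i) ltj0.
    rewrite -!(ler_nat R) !natrD ler_norml => ? ?; lra.
  have := interpolate_lipschitz R g _ gq (s / (S%:R / D%:R)) (t / (S%:R / D%:R)).
  rewrite -mulrBl -mulrBl normrM [X in _ * (_ * X)]ger0_norm ?invr_ge0 ?(ltW sg0) //.
  rewrite normrM (ger0_norm (_ : 0 <= D%:R^-1)) ?invr_ge0 ?ler0n //.
  rewrite ler_pdivrMr //= => /le_trans; apply.
  have -> : v i * `|s - t| * D%:R = v i * S%:R * (`|s - t| / (S%:R / D%:R)).
    by field; rewrite !gt_eqF.
  by rewrite ler_wpM2r // divr_ge0 // ltW.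
pose z := y * D%:R.
have z0 : 0 <= z by rewrite mulr_ge0 // ltW.
have zM : z <= M.+1%:R by rewrite -ler_pdivlMr.
(* The upper end of the fence belongs to the top cell [M]. *)
pose m := minn (Num.truncn z) M.
have mz : m%:R <= z <= m.+1%:R.
  have /andP[z1 z2] := truncn_itv z0.
  rewrite /m; have [le|lt] := leqP (Num.truncn z) M; first by rewrite z1 ltW.
  by rewrite zM andbT (le_trans _ z1) // ler_nat ltnW.
pose j := Num.ceil (t / (S%:R / D%:R)).
have /andP[j1 j2] := ceil_itv (t / (S%:R / D%:R)).
have [i [r [ltik ltr cri]]] := cr m _ (geq_minr _ _) (absz_modz_lt _ j P0).
pose w := cyclic_nth (mkseq (x i) P).
have {}cri : crosses m (w (j + r)) (w (j + r + 1)).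
  have -> : j + r + 1 = j + r.+1 :> int by rewrite -addrA -PoszD addn1.
  by rewrite /w !cyclic_nth_mkseq // addnS.
have [e [e01 eP]] := interpolate_hits R w _ _ _ cri mz.
exists (Ordinal ltik), (((j + r)%:~R + e) * (S%:R / D%:R)).
rewrite schedule_ofE wE /= mulfK ?gt_eqF // eP mulfK ?gt_eqF //; split=> //.
have r0 : 0 <= r%:R :> R by rewrite ler0n.
have rW : r%:R + 1 <= W%:R :> R by rewrite natr1 ler_nat.
move: j1 j2; rewrite -/j !intrD /= => j1 j2; apply/andP; split.
  rewrite -ler_pdivrMr //; lra.
rewrite -ltr_pdivlMr // mulrDl; move: WT; rewrite -ler_pdivlMr // -natr1; lra.
Qed.

(** * Discretization of schedules *)

(** If [k * h <= L], the k + 1 points [m * h] lie on the fence, and two of them are visited by one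
    agent during [0, T), although they are at least [h] apart. *)
Lemma fence_length_bound (R : realType) (k : nat) (v : 'I_k -> R)
    (a : 'I_k -> R -> R) (L T h : R) :
  is_schedule v a -> patrols a L T -> 0 < h ->
  (forall i, 0 <= v i) -> (forall i, v i * T < h) -> L < k%:R * h.
Proof.
move=> sch pat h0 v0 vh; rewrite ltNge; apply/negP => leL.
have visit (m : 'I_k.+1) : exists z : 'I_k * R,
    0 <= z.2 < T /\ a z.1 z.2 = m%:R * h.
  have [|i [t [tP tE]]] := pat 0 (m%:R * h).
    rewrite mulr_ge0 ?(ltW h0) //= (le_trans _ leL) // ler_wpM2r ?(ltW h0) //.
    by rewrite ler_nat -ltnS.
  by exists (i, t); rewrite add0r in tP.
have [f fP] := choice visit.
have /injectivePn[x [y nxy fxy]] : ~~ injectiveb (fun m => (f m).1).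
  by apply/negP => /injectiveP/leq_card; rewrite !card_ord ltnn.
wlog ltxy : x y nxy fxy / (x < y)%N => [hw|].
  have [lt|lt|/val_inj eqxy] := ltngtP x y; first exact: hw lt.
    by apply: (hw y x) => //; rewrite eq_sym.
  by rewrite eqxy eqxx in nxy.
have [/andP[x0 xT] xE] := fP x; have [/andP[y0 yT] yE] := fP y.
have := sch (f y).1 (f y).2 (f x).2; rewrite yE -fxy xE.
have dT : `|(f y).2 - (f x).2| <= T by rewrite ler_norml; lra.
have := ler_wpM2l (v0 (f x).1) dT; have := vh (f x).1.
have : x%:R + 1 <= y%:R :> R by rewrite natr1 ler_nat.
rewrite ler_norml => ? ? ? /andP[_ ?]; nra.
Qed.

Lemma max_increment (R : realType) (a b a' b' r : R) :
  a <= a' <= a + r -> b <= b' <= b + r ->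
  Num.max a b <= Num.max a' b' <= Num.max a b + r.
Proof. by case: (leP a b) => ?; case: (leP a' b') => ?; lra. Qed.

Lemma min_increment (R : realType) (a a' c r : R) : 0 <= r ->
  a <= a' <= a + r -> Num.min a c <= Num.min a' c <= Num.min a c + r.
Proof. by case: (leP a c) => ?; case: (leP a' c) => ?; lra. Qed.

Lemma ceil_nat (R : realType) (h r : R) : 0 < r -> 0 <= h ->
  exists j : nat, (j%:R - 1) * r < h <= j%:R * r.
Proof.
move=> r0 h0; have x0 : 0 <= h / r by rewrite divr_ge0 // ltW.
have /andP[] := ceil_itv (h / r).
have : (0 <= Num.ceil (h / r))%R by rewrite ceil_ge0; lra.
case: (Num.ceil _) => // j _; rewrite intrD ltr_pdivlMr // ler_pdivrMr // => *.
by exists j; apply/andP.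
Qed.

(** Each prescribed stop costs at most one extra step, hence [N.+2] steps for a duration of [N * r].
    The indices of the stops differ even when [h1 = h2], so that they can be labelled separately. *)
Lemma stops (R : realType) (r h1 h2 : R) (N : nat) : 0 < r ->
  0 <= h1 -> h1 <= h2 -> h2 <= N%:R * r ->
  exists (th : nat -> R) (j1 j2 : nat),
    [/\ th 0%N = 0, th N.+2 = N%:R * r,
        forall j, `|th j.+1 - th j| <= r,
        th j1 = h1 /\ th j2 = h2 & (j1 < j2 < N.+3)%N].
Proof.
move=> r0 h10 h12 h2N; have h20 := le_trans h10 h12.
have [i1 /andP[i1l i1u]] := ceil_nat _ _ _ r0 h10.
have [i2 /andP[i2l i2u]] := ceil_nat _ _ _ r0 h20.
have tau0 := le_trans h20 h2N.
have i1N : (i1 <= i2)%N.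
  rewrite -ltnS -(ltr_nat R) -natr1 -ltrBlDr -(ltr_pM2r r0).
  exact: lt_le_trans i1l (le_trans h12 i2u).
have i2N : (i2 <= N)%N.
  rewrite -ltnS -(ltr_nat R) -natr1 -ltrBlDr -(ltr_pM2r r0).
  exact: lt_le_trans i2l h2N.
(* Three walks, delayed by 0, 1 and 2 steps, head for [h1], [h2] and [N r]; the
   delays make the leading one stop at its goal before it is overtaken. *)
exists (fun j => Num.max (Num.min (j%:R * r) h1)
   (Num.max (Num.min ((j%:R - 1) * r) h2) (Num.min ((j%:R - 2) * r) (N%:R * r)))).
(* The second walk is delayed by one step, so it reaches [h2] at [i2.+1]. *)
exists i1, i2.+1; split.
- rewrite min_l ?mul0r // max_l // ge_max !ge_min; apply/andP; split.
    by apply/orP; left; nra.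
  by apply/orP; left; nra.
- have NE : (N.+2%:R : R) = N%:R + 2 by rewrite -addn2 natrD.
  rewrite NE addrK minxx.
  rewrite (max_r (_ : Num.min _ h2 <= _)) ?ge_min ?h2N ?orbT //.
  by rewrite max_r // ge_min (le_trans h12 h2N) orbT.
- move=> j.
  have : Num.max (Num.min (j%:R * r) h1)
     (Num.max (Num.min ((j%:R - 1) * r) h2) (Num.min ((j%:R - 2) * r) (N%:R * r)))
    <= Num.max (Num.min (j.+1%:R * r) h1)
     (Num.max (Num.min ((j.+1%:R - 1) * r) h2) (Num.min ((j.+1%:R - 2) * r) (N%:R * r)))
    <= Num.max (Num.min (j%:R * r) h1)
     (Num.max (Num.min ((j%:R - 1) * r) h2) (Num.min ((j%:R - 2) * r) (N%:R * r))) + r.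
    by apply: max_increment; [|apply: max_increment];
      apply: min_increment; rewrite ?(ltW r0) // -natr1; nra.
  by move: (Num.max _ _) (Num.max _ _) => A B; rewrite ler_norml; lra.
- split.
    rewrite (min_r i1u) max_l // ge_max !ge_min.
    by apply/andP; split; apply/orP; left; nra.
  rewrite -natr1 addrK (min_r i2u).
  rewrite (max_l (_ : _ <= h2)); last by rewrite ge_min; apply/orP; left; nra.
  by rewrite max_r // ge_min h12 orbT.
by rewrite !ltnS i1N ltnW.
Qed.

(** The extrema exist because [c] takes natural values up to [C]. *)
Lemma extrema_attained (R : realType) (c : R -> nat) (C : nat) (tau : R) :
  0 <= tau -> (forall t, c t <= C)%N ->
  exists t1 t2, [/\ 0 <= t1 <= tau, 0 <= t2 <= tau &
    forall t, 0 <= t <= tau -> (c t1 <= c t <= c t2)%N].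
Proof.
move=> tau0 cC; pose A n := `[< exists2 t, 0 <= t <= tau & c t = n >].
have exA : exists n, A n.
  by exists (c 0); apply/asboolP; exists 0; rewrite ?lexx.
have bA n : A n -> (n <= C)%N by move=> /asboolP[t _ <-].
have [n1 /asboolP[t1 t1P t1E] n1min] := ex_minnP exA.
have [n2 /asboolP[t2 t2P t2E] n2max] := ex_maxnP exA bA.
exists t1, t2; split=> // t tP; have At : A (c t) by apply/asboolP; exists t.
by rewrite t1E t2E n1min // n2max.
Qed.

(** The flag [z.2] is set at the maximum only and raises it to the upper end of its cell. So between
    the two stops the integer walk passes between at most [c t] and more than [c t], and crosses the
    cell of each visited point, the maximal one included. *)
Lemma block_walk (R : realType) (c : R -> nat) (C : nat) (r : R) (N : nat) :
  0 < r -> (forall t, c t <= C)%N ->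
  exists z : (nat -> R) * (nat -> bool),
    [/\ z.1 0%N = 0, z.1 N.+2 = N%:R * r,
        forall j, `|z.1 j.+1 - z.1 j| <= r &
        forall t, 0 <= t <= N%:R * r -> exists j1 j2,
          [/\ j1 < N.+3, j2 < N.+3, c (z.1 j1) + z.2 j1 <= c t
            & c t < c (z.1 j2) + z.2 j2]%N].
Proof.
move=> r0 cC; have tau0 : 0 <= N%:R * r by rewrite mulr_ge0 ?ler0n // ltW.
have [t1 [t2 [/andP[t10 t1t] /andP[t20 t2t] ext]]] :=
  extrema_attained _ _ _ _ tau0 cC.
have [le12|/ltW le21] := leP t1 t2.
  have [th [j1 [j2 [th0 thN thl [th1 th2] /andP[lt12 lt2]]]]] :=
    stops _ _ _ _ _ r0 t10 le12 t2t.
  exists (th, eq_op j2); split=> //= t /ext/andP[c1 c2]; exists j1, j2.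
  rewrite th1 th2 eqxx (gtn_eqF lt12) addn0 addn1 ltnS; split=> //.
  exact: ltn_trans lt2.
have [th [j2 [j1 [th0 thN thl [th2 th1] /andP[lt21 lt1]]]]] :=
  stops _ _ _ _ _ r0 t20 le21 t1t.
exists (th, eq_op j2); split=> //= t /ext/andP[c1 c2]; exists j1, j2.
rewrite th1 th2 eqxx (ltn_eqF lt21) addn0 addn1 ltnS; split=> //.
exact: ltn_trans lt1.
Qed.

(** The agents may leave the fence. Retracting them to it bounds their positions, does not raise
    their speeds and keeps all visits to the fence. *)
Definition clamp (R : realType) (L x : R) : R := Num.max 0 (Num.min L x).

Lemma clamp_itv (R : realType) (L x : R) : 0 <= L -> 0 <= clamp R L x <= L.
Proof.
move=> L0; rewrite /clamp.
by case: (leP L x) => ?; [case: (leP 0 L) | case: (leP 0 x)] => ?; lra.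
Qed.

Lemma clamp_id (R : realType) (L x : R) : 0 <= x <= L -> clamp R L x = x.
Proof.
move=> /andP[? ?]; rewrite /clamp.
by case: (leP L x) => ?; [case: (leP 0 L) | case: (leP 0 x)] => ?; lra.
Qed.

Lemma clamp_lipschitz (R : realType) (L x y : R) :
  `|clamp R L x - clamp R L y| <= `|x - y|.
Proof.
wlog lexy : x y / x <= y => [hw|].
  by have [/hw//|/ltW/hw] := leP x y; rewrite distrC (distrC y).
rewrite distrC (distrC x) (ger0_norm (_ : 0 <= y - x)) ?subr_ge0 // ler_norml.
by rewrite /clamp; case: (leP L x) => ?; case: (leP L y) => ?;
  case: (leP 0 L) => ?; case: (leP 0 x) => ?; case: (leP 0 y) => ?; lra.
Qed.

Lemma modn_succ_cases (j d : nat) : (0 < d)%N ->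
  (j.+1 %/ d = j %/ d /\ j.+1 %% d = (j %% d).+1)%N \/
  [/\ (j %% d).+1 = d, j.+1 %/ d = (j %/ d).+1 & j.+1 %% d = 0]%N.
Proof.
move=> d0; have E : j.+1 = (j %/ d * d + (j %% d).+1)%N by rewrite addnS -divn_eq.
have := ltn_pmod j d0; rewrite leq_eqVlt => /orP[/eqP eqd|lt]; [right|left].
  split=> //; rewrite {1}E eqd; first by rewrite divnMDl // divnn d0 addn1.
  by rewrite modnMDl modnn.
by rewrite E divnMDl // modnMDl (divn_small lt) (modn_small lt) addn0.
Qed.

(* Time is cut into blocks of length [N r].  During a block each agent is
   observed at [N + 3] moments, among which it attains the extreme cells it
   reaches in that block, so that it crosses all cells that it visits. *)
Lemma discretize (R : realType) (k : nat) (v : 'I_k -> R) (a : 'I_k -> R -> R)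
    (L T lam r : R) (N F W : nat) (q : 'I_k -> nat) :
  0 < r -> 0 < lam -> 0 <= L -> (0 < N)%N ->
  is_schedule v a -> patrols a L T ->
  (forall i, 0 <= v i) ->
  (forall i, lam * (v i * r) + 2 <= (q i)%:R) ->
  T <= F%:R * (N%:R * r) -> (F.+1 * N.+3 <= W)%N ->
  exists w : 'I_k -> nat -> nat,
    [/\ forall i j, (w i j <= (Num.truncn (lam * L)).+1)%N,
        forall i j, (w i j.+1 <= w i j + q i /\ w i j <= w i j.+1 + q i)%N &
        forall m j, (m <= Num.truncn (lam * L))%N -> exists i t,
          (t < W)%N /\ crosses m (w i (j + t)%N) (w i (j + t).+1)].
Proof.
move=> r0 lam0 L0 N0 sch pat v0 qP FT FW.
have tau0 : 0 < N%:R * r by rewrite mulr_gt0 // ltr0n.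
pose tau := N%:R * r; rewrite -/tau in tau0 FT.
pose c i t := Num.truncn (lam * clamp R L (a i t)).
have A0 i t : 0 <= lam * clamp R L (a i t).
  by have /andP[? _] := clamp_itv R L (a i t) L0; rewrite mulr_ge0 // ltW.
have cC i t : (c i t <= Num.truncn (lam * L))%N.
  apply: le_truncn; rewrite ler_pM2l //.
  by have /andP[] := clamp_itv R L (a i t) L0.
(* Of the slack 2 in the speed bound, 1 pays for rounding and 1 for the flag. *)
have cq i s t : `|s - t| <= r -> (c i s).+2%:R <= (c i t)%:R + (q i)%:R + 1 :> R.
  move=> st; have := clamp_lipschitz R L (a i s) (a i t) => cl.
  have := le_trans cl (sch i s t).
  have := ler_wpM2l (v0 i) st => vr /le_trans /(_ vr) {cl vr}.
  have := qP i; have /andP[+ _] := truncn_itv (A0 i s).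
  have /andP[_] := truncn_itv (A0 i t); rewrite -/(c i s) -/(c i t).
  move: (clamp R L (a i s)) (clamp R L (a i t)) => x y.
  rewrite -[(c i s).+2]addn2 natrD -[(c i t).+1%:R]natr1 => ht hs hq.
  rewrite ler_norml => /andP[_ xy].
  have := ler_wpM2l (ltW lam0) xy; rewrite mulrBr; lra.
have [z zP] := choice (fun iB : 'I_k * nat =>
  block_walk R (fun t => c iB.1 (iB.2%:R * tau + t)) _ r N r0 (fun t => cC iB.1 _)).
(* A block has observations 0 to [N.+2]; the last one and the first of the next block are the same
   moment. *)
pose K := N.+3; have K0 : (0 < K)%N by [].
pose th i j := (j %/ K)%:R * tau + (z (i, (j %/ K)%N)).1 (j %% K)%N.
pose s i j := (z (i, (j %/ K)%N)).2 (j %% K)%N.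
pose w i j := (c i (th i j) + s i j)%N.
have thr i j : `|th i j.+1 - th i j| <= r.
  rewrite /th; have [[-> ->]|[eqK -> ->]] := modn_succ_cases j K K0.
    have [_ _ lip _] := zP (i, (j %/ K)%N).
    rewrite [X in `|X|](_ : _ = (z (i, (j %/ K)%N)).1 (j %% K).+1 -
      (z (i, (j %/ K)%N)).1 (j %% K)%N); first exact: lip.
    by ring.
  have [z0 _ _ _] := zP (i, (j %/ K).+1); rewrite z0.
  have [_ + _ _] := zP (i, (j %/ K)%N); case: eqK => -> ->.
  by rewrite -/tau -natr1 [X in `|X|](_ : _ = 0) ?normr0 ?ltW //; ring.
have wq i j j' : `|th i j - th i j'| <= r -> (w i j <= w i j' + q i)%N.
  move=> /(cq i); rewrite -!natrD natr1 ler_nat /w.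
  by case: (s i j); case: (s i j'); lia.
exists w; split=> [i j|i j|m j lem].
- by rewrite /w -addn1 leq_add // leq_b1.
- by split; apply: wq; [|rewrite distrC]; apply: thr.
have lamL0 : 0 <= lam * L by rewrite mulr_ge0 // ltW.
have xL : 0 <= m%:R / lam <= L.
  rewrite divr_ge0 ?ler0n ?(ltW lam0) //= ler_pdivrMr // mulrC.
  by rewrite -truncn_ge_nat.
(* The schedule is asked for a visit from the start of the first block after [j]. The visit falls
   into one of [F] blocks, so with the rest of the current block [F.+1] blocks of indices
   suffice. *)
pose B0 := (j %/ K).+1.
have [i [t [/andP[t1 t2] at_]]] := pat (B0%:R * tau) _ xL.
have ct : c i t = m.
  by rewrite /c at_ clamp_id // mulrC divfK ?gt_eqF // natrK.
pose B1 := Num.truncn ((t - B0%:R * tau) / tau); pose B := (B0 + B1)%N.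
have d0 : 0 <= (t - B0%:R * tau) / tau by rewrite divr_ge0 ?(ltW tau0) // subr_ge0.
have /andP[B1l B1u] := truncn_itv d0.
have B1F : (B1 < F)%N.
  rewrite truncn_lt_nat // ltr_pdivrMr //; lra.
have tB : 0 <= t - B%:R * tau <= tau.
  move: B1l B1u; rewrite -/B1 /B natrD -natr1 ler_pdivlMr // ltr_pdivrMr //.
  by move=> ? ?; rewrite mulrDl; lra.
have [_ _ _ /(_ _ tB) [j1 [j2 [lt1 lt2 le1 le2]]]] := zP (i, B).
have wB l : (l < K)%N -> w i (B * K + l)%N =
    (c i (B%:R * tau + (z (i, B)).1 l)%R + (z (i, B)).2 l)%N.
  move=> ltl; rewrite /w /th /s divnMDl // modnMDl.
  by rewrite (divn_small ltl) (modn_small ltl) addn0.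
have tE : B%:R * tau + (t - B%:R * tau) = t by rewrite addrC subrK.
move: le1 le2; rewrite /= tE ct -!wB // => le1 le2.
have [l [l1 l2 cr]] := crosses_between _ _ _ _ le1 le2.
have jB0 : (j < B0 * K)%N by rewrite -ltn_divLR.
have B0j : (B0 * K <= j + K)%N.
  by rewrite mulSn addnC leq_add2r leq_divM.
have BF : (B * K + K <= B0 * K + F * K)%N.
  by rewrite -mulSnr -mulnDl leq_mul2r /B -addnS leq_add2l B1F orbT.
have B0B : (B0 * K <= B * K)%N by rewrite leq_mul2r leq_addr orbT.
have lej : (j <= l)%N.
  apply: leq_trans (ltnW jB0) (leq_trans B0B (leq_trans _ l1)).
  by rewrite leq_min !leq_addr.
have ltl : (l < j + W)%N.
  apply: (leq_trans l2); apply: (@leq_trans (B * K + K)).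
    by rewrite geq_max !leq_add2l (ltnW lt1) (ltnW lt2).
  apply: (leq_trans BF); move: FW; rewrite mulSn => FW.
  by apply: leq_trans (leq_add B0j (leqnn _)) _; rewrite -addnA leq_add2l.
exists i, (l - j)%N; rewrite subnKC //; split=> //.
by rewrite ltn_subLR.
Qed.

(** * Optimality of the answer *)

Lemma approximates_itv (R : realType) (u : nat -> nat) (x : R) (n : nat) :
  approximates u x -> (u n)%:R - 1 <= x * 2 ^+ n <= (u n)%:R + 1.
Proof.
move=> /(_ n); have D0 : 0 < 2 ^+ n :> R by rewrite exprn_gt0.
rewrite -(ler_pM2r D0) mulVf ?gt_eqF // -{2}(gtr0_norm D0) -normrM mulrBl.
by rewrite divfK ?gt_eqF // ler_norml; lra.
Qed.

(** A threshold is given rather than a single precision, so that the time and all speeds can share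
    one. *)
Lemma approximates_unbounded (R : realType) (u : nat -> nat) (x : R) (C : nat) :
  0 < x -> approximates u x -> exists n0, forall n, (n0 <= n)%N -> (C <= u n)%N.
Proof.
move=> x0 ux; exists (Num.bound ((C%:R + 1) / x)) => n /upper_nthrootP.
rewrite ltr_pdivrMr // mulrC => lt; have /andP[_ le] := approximates_itv R u x n ux.
rewrite -(ler_nat R); lra.
Qed.

Lemma precise_exists (R : realType) (k : nat) (v : 'I_k -> R) (T : R)
    (o : nat -> nat -> nat) :
  (forall i, 0 < v i) -> 0 < T -> approximates (o 0%N) T ->
  (forall i : 'I_k, approximates (o i.+2) (v i)) ->
  forall e, exists n, precise o k e n.
Proof.
move=> v0 T0 oT ov e; rewrite /precise; move: (200 * _)%N => C.
have [n0 n0P] := approximates_unbounded _ _ _ C T0 oT.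
have [f fP] := choice (fun i => approximates_unbounded _ _ _ C (v0 i) (ov i)).
exists (maxn n0 (\max_i f i)); rewrite n0P ?leq_maxl //=.
apply/allP => i; rewrite mem_iota => ltik; apply: (fP (Ordinal ltik)).
by rewrite (leq_trans _ (leq_maxr _ _)) // leq_bigmax.
Qed.

(** A block covers 12 E + 6 units of schedule time in 12 E + 3 steps. If there are many blocks, the
    3 units gained in each pay for the two extra blocks; if there are few, the left side is below
    200 E^2 - 2. *)
Lemma window_fits (E F U : nat) : (2 <= E)%N -> (200 * (E * E) <= U)%N ->
  ((F - 1) * (12 * E + 6) <= U)%N -> (F.+1 * (12 * E).+3 <= U - 2)%N.
Proof.
move=> E2 EU; case: F => [|F]; first by move=> _; nia.
rewrite subn1 /= => FU; have [le|lt] := leqP (8 * E + 3) F; first by nia.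
by have : ((F + 2) * (12 * E + 3) <= (8 * E + 5) * (12 * E + 3))%N; [nia|nia].
Qed.

Lemma speed_fits (R : realType) (E : nat) (X V : R) : (2 <= E)%N ->
  200 * (E%:R * E%:R) <= V -> V - 1 <= X <= V + 1 ->
  (1 - E%:R^-1) * (1 + (2 * E%:R)^-1) * X + 2 <= V - 1.
Proof.
move=> E2 EV /andP[X1 X2]; have E2' : 2 <= E%:R :> R by rewrite ler_nat.
have nzE : E%:R != 0 :> R by lra.
have y0 : 0 < E%:R^-1 :> R by rewrite invr_gt0; lra.
(* Half of this saving, at least 4, pays for the 2 on the left and for the distance 2 between
   [V - 1] and [V + 1]. *)
have yX : 8 <= E%:R^-1 * X by rewrite mulrC ler_pdivlMr; nra.
have -> : (1 - E%:R^-1) * (1 + (2 * E%:R)^-1) * X =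
  X - E%:R^-1 * X / 2 - E%:R^-1 * (E%:R^-1 * X) / 2 :> R by field.
have : 0 <= E%:R^-1 * (E%:R^-1 * X) by rewrite mulr_ge0 //; lra.
lra.
Qed.

Lemma natr_subn1 (R : realType) (m : nat) : (0 < m)%N -> (m - 1)%:R = m%:R - 1 :> R.
Proof. by move=> m0; rewrite natrB. Qed.

(** Discretizing the shrunk and accelerated schedule and repeating a part of it gives a table within
    the search range; its top cell ends beyond (1 - 1 / E) L because truncation loses less than one
    cell. *)
Lemma valid_index_exists (R : realType) (k : nat) (v : 'I_k -> R) (T L : R)
    (a : 'I_k -> R -> R) (o : nat -> nat -> nat) (e n : nat) :
  (0 < k)%N -> (forall i, 0 < v i) -> 0 < T -> 0 <= L ->
  approximates (o 0%N) T ->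
  (forall i : 'I_k, approximates (o i.+2) (v i)) ->
  precise o k e.+1 n -> is_schedule v a -> patrols a L T ->
  let b := bound o k n in let P := period b k (o 0%N n - 2) in
  exists s, [/\ (s < b * b ^ (k * P))%N, valid_index o k n b P s &
    (1 - (2 ^ e.+1)%:R^-1) * L <=
      (s %/ b ^ (k * P)).+1%:R / (2 ^ (n + n))%:R].
Proof.
move=> k0 v0 T0 L0 oT ov /andP[]; set E := (2 ^ e.+1)%N => EU /allP EV sch pat b P.
have {}EV (i : 'I_k) : (200 * (E * E) <= o i.+2 n)%N.
  by apply: (EV (nat_of_ord i)); rewrite mem_iota add0n ltn_ord.
have E2 : (2 <= E)%N by rewrite /E expnS leq_pmulr // expn_gt0.
have E2' : 2 <= E%:R :> R by rewrite ler_nat.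
have nzE : E%:R != 0 :> R by lra.
pose D : R := 2 ^+ n; have D0 : 0 < D by rewrite exprn_gt0.
have DD : (2 ^ (n + n))%:R = D * D :> R by rewrite natrX exprD.
have /andP[T1 T2] := approximates_itv _ _ _ n oT; rewrite -/D in T1 T2.
have vP i := approximates_itv _ _ _ n (ov i); rewrite -/D in vP.
have y0 : 0 < (E%:R^-1 : R) <= 2^-1.
  by rewrite invr_gt0 lef_pV2 ?posrE ?E2' ?andbT //; lra.
(* Space is shrunk by 1 - 1 / E, and one step of 1 / D in the table stands for 1 + 1 / (2 E) times
   as much time in the schedule. *)
pose lam := (1 - E%:R^-1) * (D * D); pose r := (1 + (2 * E%:R)^-1) / D.
have r0 : 0 < r by rewrite divr_gt0 // addr_gt0 // invr_gt0; lra.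
have lam0 : 0 < lam by rewrite !mulr_gt0 //; lra.
have Nr : (12 * E)%:R * r = (12 * E + 6)%:R / D.
  by rewrite /r (natrD _ (12 * E)) (natrM _ 12); field; rewrite gt_eqF.
have N0 : 0 < (12 * E)%:R * r by rewrite mulr_gt0 // ltr0n muln_gt0 (ltnW E2).
have [F /andP[Fl Fu]] := ceil_nat _ _ _ N0 (ltW T0).
have FU : ((F - 1) * (12 * E + 6) <= o 0%N n)%N.
  case: F Fl {Fu} => [|F] //; rewrite subn1 /= Nr -natr1 addrK mulrA.
  rewrite ltr_pdivrMr // -natrM => lt.
  by rewrite -ltnS -(ltr_nat R) -natr1; lra.
have FW := window_fits _ _ _ E2 EU FU.
have vlam i : lam * (v i * r) + 2 <= (o (nat_of_ord i).+2 n - 1)%:R.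
  have -> : lam * (v i * r) =
      (1 - E%:R^-1) * (1 + (2 * E%:R)^-1) * (v i * D).
    by rewrite /lam /r; field; rewrite nzE gt_eqF.
  rewrite natr_subn1; last first.
    by apply: leq_trans (EV i); rewrite !muln_gt0 (ltnW E2).
  by apply: speed_fits => //; rewrite -!natrM ler_nat.
have E12 : (0 < 12 * E)%N by rewrite muln_gt0 (ltnW E2).
have [w [wb wst wcr]] := discretize _ _ _ _ _ _ _ _ _ _ _ _ r0 lam0 L0
  E12 sch pat (fun i => ltW (v0 i)) vlam Fu FW.
pose M := Num.truncn (lam * L).
have Mb : (M.+1 < b)%N.
  (* [H] exceeds every v T in units of 1 / D^2, so L < k H / D^2; positions up to [M.+1] are then
     digits in base [b], and [M] itself is in the search range. *)
  pose S := (\sum_(i < k) (o i.+2 n).+1)%N.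
  pose H := (S * (o 0%N n).+1 + 1)%N.
  have H0 : 0 < H%:R / (D * D) :> R by rewrite divr_gt0 ?mulr_gt0 // ltr0n /H addn1.
  have : L < k%:R * (H%:R / (D * D)).
    apply: (fence_length_bound R k v a L T) => // i; first exact: ltW.
    rewrite ltr_pdivlMr ?mulr_gt0 //.
    have -> : v i * T * (D * D) = (v i * D) * (T * D) by ring.
    apply: (@le_lt_trans _ _ ((o i.+2 n).+1%:R * (o 0%N n).+1%:R)).
      have /andP[_ ?] := vP i.
      by apply: ler_pM; rewrite ?mulr_ge0 ?(ltW D0) ?(ltW T0) ?(ltW (v0 i)) // -natr1.
    by rewrite -natrM ltr_nat /H addn1 ltnS leq_mul2r /S (bigD1 i) //= leq_addr.
  rewrite mulrA ltr_pdivlMr ?mulr_gt0 // -natrM => LH.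
  have : (M < k * H)%N.
    rewrite /M truncn_lt_nat; last by rewrite mulr_ge0 // ltW.
    apply: le_lt_trans LH; rewrite mulrC ler_wpM2l //.
    by rewrite ler_piMl ?mulr_ge0 ?(ltW D0) //; lra.
  by move=> ltM; rewrite (_ : b = (k * H + 2)%N) // addn2 !ltnS ltnW.
(* [w] is extended to all natural numbers as agents, with position 0 for those not in ['I_k]. *)
pose x i j := oapp (w^~ j) 0%N (insub i).
have xE (i : 'I_k) j : x i j = w i j by rewrite /x valK.
have [] := valid_table_exists k b (o 0%N n - 2) (fun i => o i.+2 n - 1)%N x M.
- by [].
- rewrite subn_gt0; apply: leq_trans EU.
  by apply: (@leq_trans 200) => //; rewrite leq_pmulr // muln_gt0 (ltnW E2).
- by move=> i j ltik; rewrite (xE (Ordinal ltik)); apply: leq_ltn_trans (wb _ _) Mb.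
- by move=> i j ltik; rewrite !(xE (Ordinal ltik)); apply: wst.
- move=> m j /(wcr m j)[i [t [ltt cr]]]; exists i, t; rewrite !xE.
  by split.
rewrite -/P => Nn ltN val; exists (M * b ^ (k * P) + Nn)%N.
have B0 : (0 < b ^ (k * P))%N by apply: leq_ltn_trans ltN.
have sM : ((M * b ^ (k * P) + Nn) %/ b ^ (k * P) = M)%N.
  by rewrite divnMDl // divn_small // addn0.
have sN : ((M * b ^ (k * P) + Nn) %% b ^ (k * P) = Nn)%N.
  by rewrite modnMDl modn_small.
split; last first.
- by rewrite sM DD ler_pdivlMr ?mulr_gt0 // mulrAC ltW // truncnS_gt.
- by rewrite /valid_index sM sN.
apply: (@leq_trans (M.+1 * b ^ (k * P))); first by rewrite mulSnr ltn_add2l.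
by rewrite leq_mul2r (ltnW Mb) orbT.
Qed.

Theorem theorem1 (R : realType) :
  exists p : program,
    forall (k : nat) (v : 'I_k -> R) (T eps : R) (o : nat -> nat -> nat),
      (0 < k)%N ->
      (forall i : 'I_k, 0 < v i) -> 0 < T -> 0 < eps ->
      approximates (o 0%N) T ->
      approximates (o 1%N) eps ->
      (forall i : 'I_k, approximates (o i.+2) (v i)) ->
      exists d : description,
        eval o p [:: k] (encode d) /\
        is_schedule v (schedule_of R k d) /\
        exists ell : R,
          0 <= ell /\
          patrols (schedule_of R k d) ell T /\
          forall L : R, 0 <= L ->
            (exists a : 'I_k -> R -> R, is_schedule v a /\ patrols a L T) ->
            (1 - eps) * L <= ell.
Proof.
have [p pP] := program_of_answer; exists p => k v T eps o k0 v0 T0 eps0 oT oeps ov.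
have [||e [n [eP nP ev]]] := pP o k.
- have [n0 n0P] := approximates_unbounded _ _ _ 2 eps0 oeps.
  by exists n0; apply: n0P.
- exact: (precise_exists R k v T).
exists (answer o k n); split=> //.
pose b := bound o k n; pose P := period b k (o 0%N n - 2).
have best := valid_index_exists R k v T _ _ o e n k0 v0 T0 _ oT ov nP.
pose s' := last_index o k n b P.
have val : valid_index o k n b P s'.
  (* Agents at rest patrol a fence of length 0, so the search has a success and [s'] is valid, not a
     mere default. *)
  have [||s [lts vs _]] := best 0 (fun _ _ => 0) (lexx _).
  - by move=> i s t; rewrite subrr normr0 mulr_ge0 // ltW.
  - move=> t x; rewrite -eq_le => /eqP <-; exists (Ordinal k0), t; split=> //.
    by rewrite lexx ltrDl.
  by have [] := last_index_valid _ _ _ _ _ _ lts vs.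
pose M' := (s' %/ b ^ (k * P))%N.
have D0 : (0 < 2 ^ n)%N by rewrite expn_gt0.
have DD0 : (0 < 2 ^ (n + n))%N by rewrite expn_gt0.
have Dr : 0 < 2 ^+ n :> R by rewrite exprn_gt0.
have /andP[EU /allP EV] := nP.
have E0 : (0 < 2 ^ e.+1 * 2 ^ e.+1)%N by rewrite muln_gt0 expn_gt0.
have [||sch pat] := valid_schedule R k v T (2 ^ (n + n)) (2 ^ n) P (o 0%N n - 2) M'
  (fun i => o i.+2 n - 1)%N _ (period_gt0 _ _ _) DD0 D0 val.
- move=> i; have /andP[+ _] := approximates_itv _ _ _ n (ov i).
  rewrite natr_subn1 ?natrX //.
  apply: leq_trans (EV (nat_of_ord i) _); first by rewrite muln_gt0 E0.
  by rewrite mem_iota add0n ltn_ord.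
- have /andP[+ _] := approximates_itv _ _ _ n oT.
  have U2 : (1 < o 0%N n)%N.
    by apply: leq_trans EU; apply: (@leq_trans 200) => //; rewrite leq_pmulr.
  have -> : (o 0 n - 2).+1 = (o 0 n - 1)%N by rewrite subn1 subn2; case: (o 0%N n) U2 => [|[]].
  rewrite natr_subn1; last exact: ltnW.
  rewrite !natrX exprD invfM mulVKf ?gt_eqF // ler_pdivrMr //.
split=> //; exists (M'.+1%:R / (2 ^ (n + n))%:R); split.
  by rewrite divr_ge0 ?ler0n.
split=> // L L0 [a [scha pata]].
(* The index found for [L] is at most [s'], and division by [b ^ (k * P)] keeps this order: the
   topmost cell of the answer is no lower. *)
have [s [lts vs sL]] := best L a L0 scha pata.
have [_ les] := last_index_valid _ _ _ _ _ _ lts vs.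
apply: (@le_trans _ _ ((1 - (2 ^ e.+1)%:R^-1) * L)).
  rewrite ler_wpM2r // lerD2l lerN2.
  have /andP[epsE _] := approximates_itv _ _ _ e oeps.
  have De : 0 < 2 ^+ e :> R by rewrite exprn_gt0.
  rewrite natrX exprS invfM ler_pdivrMr //.
  move: eP; rewrite -(ler_nat R); nra.
apply: (le_trans sL); rewrite ler_pM2r ?invr_gt0 ?ltr0n //.
by rewrite ler_nat ltnS leq_div2r.
Qed.
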